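(* Let $\mathcal{A}$ be a central hyperplane arrangement defined over a field of characteristic zero. Let $c\mathcal{A}$ be the cone over $\mathcal{A}$ with additional hyperplane $H_0$, and identify $\{\underline{x}\in\mathcal{L}(c\mathcal{A}):\underline{x}\ge H_0\}$ with $\mathcal{L}(\mathcal{A})$. Then $$(1+X)\,\mathsf{mfHP}_{\mathcal{A}}\big(X,(T_x)_{x\in\mathcal{L}(\mathcal{A})}\big)=\mathsf{fHP}_{c\mathcal{A}}\Big(X,\big((-X)^{\mathrm{rk}(y)}\big)_{y\not\ge H_0},(T_x)_{\underline{x}\ge H_0}\Big),$$ i.e. the right-hand side is obtained from $\mathsf{fHP}_{c\mathcal{A}}$ by substituting $(-X)^{\mathrm{rk}(y)}$ for the variable indexed by each $y\in\mathcal{L}(c\mathcal{A})\setminus\{\hat 0\}$ with $y\not\ge H_0$, and $T_x$ for the variable indexed by each $\underline{x}\in\mathcal{L}(c\mathcal{A})$ with $\underline{x}\ge H_0$, where $x\in\mathcal{L}(\mathcal{A})$ corresponds to $\underline{x}$.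
   Context: A hyperplane arrangement $\mathcal{A}$ over a field $K$ is a finite set of affine hyperplanes in $K^d$, $d=\dim(\mathcal{A})$. Its intersection poset $\mathcal{L}(\mathcal{A})$ consists of all non-empty intersections of hyperplanes of $\mathcal{A}$ together with $\hat 0=K^d$, ordered by reverse inclusion and ranked by codimension, $\mathrm{rk}$. It is central if $\bigcap_{H\in\mathcal{A}}H\ne\varnothing$. The Poincaré polynomial is $\pi_{\mathcal{A}}(t)=\sum_{x\in\mathcal{L}(\mathcal{A})}\mu(x)(-t)^{\mathrm{rk}(x)}$, with $\mu(x)=\mu(\hat 0,x)$ the Möbius function of $\mathcal{L}(\mathcal{A})$. For $x\in\mathcal{L}(\mathcal{A})$ put $\mathcal{A}_x=\{H\in\mathcal{A}:H\supseteq x\}$, and let $\mathcal{A}^x=\{H\cap x: H\in\mathcal{A}\setminus\mathcal{A}_x,\ H\cap x\neq\varnothing\}$, an arrangement in $x$; set $\mathcal{A}_{\varnothing}=\mathcal{A}$ and $\mathcal{A}_x^y=(\mathcal{A}_x)^y$ for $y\le x$. The empty arrangement has Poincaré polynomial $1$. For a poset $P$, $\Delta(P)$ is the set of finite flags (chains) $F=(x_1<\dots<x_l)$ in $P$, including the empty flag. For $F=(x_1<\dots<x_l)\in\Delta(\mathcal{L}(\mathcal{A}))$ put $\pi_F(X)=\prod_{i=0}^{l}\pi_{\mathcal{A}_{x_{i+1}}^{x_i}}(X)$ with $x_0=\hat 0$, $x_{l+1}=\varnothing$. Let $\min(F)=x_1$ for non-empty $F$ and $\min(\varnothing)=\varnothing$,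 and set $\underline{\pi}_F(X)=\pi_F(X)/\pi_{\mathcal{A}_{\min(F)}}(X)\in\mathbb{Z}[X]$. The flag Hilbert–Poincaré series is $\mathsf{fHP}_{\mathcal{A}}(X,(T_x)_{x\in\mathcal{L}(\mathcal{A})\setminus\{\hat 0\}})=\sum_{F\in\Delta(\mathcal{L}(\mathcal{A})\setminus\{\hat 0\})}\pi_F(X)\prod_{x\in F}\frac{T_x}{1-T_x}$. The truncated flag Hilbert–Poincaré series is $\mathsf{mfHP}_{\mathcal{A}}(X,(T_x)_{x\in\mathcal{L}(\mathcal{A})})=\sum_{F\in\Delta(\mathcal{L}(\mathcal{A}))}\underline{\pi}_F(X)\prod_{x\in F}\frac{T_x}{1-T_x}$. Here $X$ and the $T_x$ are indeterminates. Cone: if $\mathcal{A}$ is defined by polynomials $L_H(X_1,\dots,X_d)$ of degree one, the cone $c\mathcal{A}$ is the central arrangement in $K^{d+1}$ (coordinates $X_0,\dots,X_d$) defined by the homogenisations (using $X_0$) of the $L_H$, together with $X_0$; $H_0=\ker(X_0)$. For central $\mathcal{A}$, the map $x\mapsto\underline{x}=cx\cap H_0$, where $cx\subseteq K^{d+1}$ is cut out by the homogenised equations of $x$, is an isomorphism of posets from $\mathcal{L}(\mathcal{A})$ onto $\{\underline{x}\in\mathcal{L}(c\mathcal{A}):\underline{x}\ge H_0\}$. *)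

(* Defs.v *)
From HB Require Import structures.
From mathcomp Require Import all_boot all_order all_algebra.
From mathcomp Require Import fraction finmap.
From mathcomp Require Import mpoly.
From mathcomp Require Import boolp classical_sets cardinality fsbigop.

Set Implicit Arguments.
Unset Strict Implicit.
Unset Printing Implicit Defensive.

Import Order.TTheory GRing.Theory Num.Theory.

Local Open Scope fset_scope.
Local Open Scope classical_set_scope.
Local Open Scope ring_scope.

(* The ambient affine space is part of the data, so that the restriction A^x
   is an arrangement in the flat x itself, without a choice of coordinates. *)
Record arrangement (K : fieldType) (n : nat) := Arrangement {
  ambient : set 'rV[K]_n;
  hyperplanes : {fset (set 'rV[K]_n)} }.

Section Arrangements.
Variables (K : fieldType) (n : nat).
Implicit Types (A : arrangement K n) (x y E : set 'rV[K]_n).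

Definition localization A x : arrangement K n :=
  Arrangement (ambient A)
    [fset H in hyperplanes A | `[< x `<=` H >]].

Definition restriction A x : arrangement K n :=
  Arrangement x
    [fset H `&` x | H in hyperplanes A
                  & ~~ `[< x `<=` H >] && (H `&` x != set0)].

Definition central A : Prop :=
  ambient A `&` \bigcap_(H in [set` hyperplanes A]) H !=set0.

(* The elements of the intersection poset. The order is reverse inclusion;
   the empty subfamily contributes the minimum [ambient A]. *)
Definition flats A : {fset (set 'rV[K]_n)} :=
  [fset x in [fset ambient A `&` \bigcap_(H in [set` S]) H
             | S : {fset (set 'rV[K]_n)} in fpowerset (hyperplanes A)]
   | x != set0].

(* [E = p + U] determines the linear subspace [U]. *)
Definition direction E : {vspace 'rV[K]_n} :=
  xget 0%VS [set U | exists p, E = [set v | v - p \in U]].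

Definition affdim E : nat := \dim (direction E).

Definition rank A x : nat := (affdim (ambient A) - affdim x)%N.

(* [mobius_rec A k x] is mu(0,x) as soon as [k] exceeds the number of elements
   of the poset strictly below [x], i.e. of flats strictly containing [x]. *)
Fixpoint mobius_rec A (k : nat) x : int :=
  if k is k'.+1 then
    if x == ambient A then 1
    else - \sum_(z <- flats A | `[< x `<` z >]) mobius_rec A k' z
  else 0.

Definition mobius A x : int := mobius_rec A #|` flats A| x.

Definition poincare A : {poly int} :=
  \sum_(x <- flats A) mobius A x *: (- 'X) ^+ rank A x.

(* The flag x_1 < ... < x_l is the sequence [:: x_1; ...; x_l]. *)
Definition flags (P : {fset (set 'rV[K]_n)}) : set (seq (set 'rV[K]_n)) :=
  [set F | {subset F <= P} /\ sorted (fun x y => `[< y `<` x >]) F].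

(* Indices are shifted: the i-th entry of [ambient A :: F] is x_i, and the i-th
   entry of [F], padded with the empty set, is x_{i+1}. The padding is sound
   since every hyperplane contains the empty set: [localization A set0] is A. *)
Definition flag_poincare A (F : seq (set 'rV[K]_n)) : {poly int} :=
  \prod_(i < (size F).+1)
    poincare (restriction (localization A (nth set0 F i))
                          (nth set0 (ambient A :: F) i)).

Definition flag_min (F : seq (set 'rV[K]_n)) : set 'rV[K]_n := head set0 F.

Section Series.
Variables (R : fieldType) (X : R) (T : set 'rV[K]_n -> R).

Definition evalz (p : {poly int}) : R := (map_poly intr p).[X].

Definition reduced_flag_poincare A (F : seq (set 'rV[K]_n)) : R :=
  evalz (flag_poincare A F) / evalz (poincare (localization A (flag_min F))).

(* Both index sets are finite, as the finitely supported sums require.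
   [fHP] makes sense when no T_x equals 1; [mfHP] moreover divides by values
   of Poincare polynomials at X, and is meant for a transcendental X. *)
Definition fHP A : R :=
  \sum_(F \in flags (flats A `\ ambient A)%fset)
    evalz (flag_poincare A F) * \prod_(x <- F) (T x / (1 - T x)).

Definition mfHP A : R :=
  \sum_(F \in flags (flats A))
    reduced_flag_poincare A F * \prod_(x <- F) (T x / (1 - T x)).

End Series.

(* [(a, b)] is the polynomial a_1 X_1 + ... + a_n X_n + b. *)
Definition affine_form : Type := 'cV[K]_n * K.

Definition zeros (l : affine_form) : set 'rV[K]_n :=
  [set v | (v *m l.1) ord0 ord0 + l.2 = 0].

Definition defined_by (A : {fset (set 'rV[K]_n)})
    (L : set 'rV[K]_n -> affine_form) : Prop :=
  forall H, H \in A -> (L H).1 != 0 /\ H = zeros (L H).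

End Arrangements.

Section Indeterminates.
Variables (K : fieldType) (n : nat) (P : {fset (set 'rV[K]_n)}).

(* Q(X, T_x : x in P), as the fraction field of Z[X][T_x : x in P]. *)
Definition ratfun : fieldType := {fraction {mpoly {poly int}[#|{: P}|]}}.

Definition varX : ratfun := tofrac (('X : {poly int})%:MP).

Definition varT (x : set 'rV[K]_n) : ratfun :=
  if insub x is Some u then
    tofrac ('X_(enum_rank (u : P)) : {mpoly {poly int}[#|{: P}|]})
  else 0.

End Indeterminates.

Section Cone.
Variables (K : fieldType) (d : nat).
Variables (A : {fset (set 'rV[K]_d)}) (L : set 'rV[K]_d -> affine_form K d).

Definition homogenize (l : affine_form K d) : affine_form K (1 + d) :=
  (col_mx l.2%:M l.1, 0).

Definition coneH0 : set 'rV[K]_(1 + d) := [set w | w ord0 (lshift d ord0) = 0].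

Definition cone : arrangement K (1 + d) :=
  Arrangement setT (coneH0 |` [fset zeros (homogenize (L H)) | H in A])%fset.

Definition cone_flat (x : set 'rV[K]_d) : set 'rV[K]_(1 + d) :=
  \bigcap_(H in [set H | H \in A /\ x `<=` H]) zeros (homogenize (L H)).

Definition underline (x : set 'rV[K]_d) : set 'rV[K]_(1 + d) :=
  cone_flat x `&` coneH0.

Definition underline_inv (y : set 'rV[K]_(1 + d)) : set 'rV[K]_d :=
  xget set0 [set x | x \in flats (Arrangement setT A) /\ underline x = y].

(* y >= coneH0 in the intersection poset means that the hyperplane contains y. *)
Definition cone_subst (R : fieldType) (X : R) (T : set 'rV[K]_d -> R)
    (y : set 'rV[K]_(1 + d)) : R :=
  if `[< y `<=` coneH0 >] then T (underline_inv y) else (- X) ^+ rank cone y.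

End Cone.

(* Main.v *)
(* Both series are sums over flags weighted by products of Poincare polynomials
   of intervals of the intersection poset P of B = cA. Write q(y) = (-X)^rk(y).
   Removing the last element of a flag, the sum Omega(x) over all flags of
   proper flats strictly below x satisfies
     Omega(x) = pi[0,x](X) + sum_(0 < y < x) Omega(y) t(y) pi[y,x](X)
   with t = T/(1-T). The dual Moebius identity sum_y mu(y,z) = [z = 0], taken
   over P and over the flats above H_0, gives
     sum_(y <= x, y not >= H_0) q(y) pi[y,x](X) = 1 - [x >= H_0] (-X).
   Hence Omega(y) = 1 - q(y) for y not >= H_0, so that t(y) Omega(y) = q(y), and
   for x >= H_0 all the terms with y not >= H_0 collapse to 1 + X. What remains
   is (1 + X) times the recursion satisfied by the truncated series of A, since
   v |-> (0, v - p), with p a common point of the hyperplanes of A, maps the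
   flats of A onto the flats of B contained in H_0. *)
Require Import Defs.
From HB Require Import structures.
From mathcomp Require Import all_boot all_order all_algebra.
From mathcomp Require Import fraction finmap.
From mathcomp Require Import mpoly.
From mathcomp Require Import boolp classical_sets cardinality fsbigop.

Set Implicit Arguments.
Unset Strict Implicit.
Unset Printing Implicit Defensive.

Import Order.TTheory GRing.Theory Num.Theory.

Local Open Scope fset_scope.
Local Open Scope classical_set_scope.
Local Open Scope ring_scope.

(** * Flags *)

Lemma in_fset_sep (T : choiceType) (P : {fset T}) (Q : pred T) z :
  (z \in [fset z in P | Q z]) = (z \in P) && Q z.
Proof. by rewrite !inE. Qed.

Lemma ltn_card_subset (T : choiceType) (A B : {fset T}) x :
  {subset A <= B} -> x \in B -> x \notin A -> (#|` A| < #|` B|)%N.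
Proof.
move=> sAB xB xA; apply: fproper_ltn_card; rewrite fproperE.
apply/andP; split; first exact/fsubsetP.
by apply/fsubsetPn; exists x.
Qed.

Lemma sum_fset_pred1 (R : nmodType) (T : choiceType) (P : {fset T}) x
  (f : T -> R) : x \in P -> \sum_(z <- P | z == x) f z = f x.
Proof. by move=> xP; rewrite -big_filter filter_pred1_uniq ?big_seq1. Qed.

Section FlagSums.
Variables (K : fieldType) (n : nat).
Implicit Types (P : {fset (set 'rV[K]_n)}) (x y : set 'rV[K]_n).

Lemma proper_rev_trans : transitive (fun x y : set 'rV[K]_n => `[< y `<` x >]).
Proof.
move=> y x z /asboolP[yx xy] /asboolP[zy yz]; apply/asboolP; split.
  exact: subset_trans zy yx.
by move=> xz; apply: xy; apply: subset_trans xz zy.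
Qed.

Lemma proper_rev_irr : irreflexive (fun x y : set 'rV[K]_n => `[< y `<` x >]).
Proof. by move=> x; apply/asboolP => -[_]; apply. Qed.

(** A strictly sorted sequence has no repetition, so its length is at most the cardinality of [P];
    there are finitely many sequences of bounded length over a finite set. *)
Lemma finite_flags P : finite_set (flags P).
Proof.
pose B k := [set F : seq (set 'rV[K]_n) | (size F <= k)%N /\ {subset F <= P}].
have finB k : finite_set (B k).
  elim: k => [|k IHk].
    by apply: (@sub_finite_set _ _ [set [::]]) => // -[|x s] [].
  apply: (@sub_finite_set _ _
    ([set [::]] `|` (fun z => z.1 :: z.2) @` ([set` P] `*` B k))).
    move=> [|x s] [szs sP]; [by left|right; exists (x, s) => //].
    split; first exact: (sP _ (mem_head _ _)).
    by split=> // z zs; apply: sP; rewrite inE zs orbT.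
  rewrite finite_setU; split=> //; apply: finite_image; apply: finite_setX => //.
apply: sub_finite_set (finB #|` P|) => F [FP Fs]; split=> //.
apply: uniq_leq_size => //.
exact: sorted_uniq proper_rev_trans proper_rev_irr _ Fs.
Qed.

Lemma flags_rconsP P F y :
  flags P (rcons F y) <-> y \in P /\ flags [fset z in P | `[< y `<` z >]] F.
Proof.
split=> [[sP] | [yP [sF oF]]].
  rewrite sorted_pairwise ?pairwise_rcons; last exact: proper_rev_trans.
  rewrite -sorted_pairwise; last exact: proper_rev_trans.
  move=> /andP[/allP Fy oF]; split.
    by apply: sP; rewrite mem_rcons mem_head.
  split=> // z zF; rewrite in_fset_sep Fy // andbT.
  by apply: sP; rewrite mem_rcons inE zF orbT.
split=> [z|].
  by rewrite mem_rcons inE => /predU1P[->//|/sF]; rewrite in_fset_sep => /andP[].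
rewrite sorted_pairwise ?pairwise_rcons; last exact: proper_rev_trans.
rewrite -sorted_pairwise; last exact: proper_rev_trans.
by rewrite oF andbT; apply/allP => z /sF; rewrite in_fset_sep => /andP[].
Qed.

(** Flags are split at their last, i.e. smallest, set [y]; what precedes [y] is an arbitrary flag of
    sets strictly containing [y]. *)
Lemma sum_flags_rcons (R : nmodType) P (g : seq (set 'rV[K]_n) -> R) :
  \sum_(F \in flags P) g F = g [::] +
    \sum_(y <- P) \sum_(F \in flags [fset z in P | `[< y `<` z >]])
      g (rcons F y).
Proof.
rewrite [LHS](fsbig_finite _ _ (finite_flags P)).
under [in RHS]eq_bigr => y _ do rewrite (fsbig_finite _ _ (finite_flags _)).
rewrite -(big_allpairs_dep (h := fun y F => rcons F y) (F := g)).
set s := flatten _; transitivity (\sum_(F <- [::] :: s) g F).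
2: by rewrite big_cons.
rewrite {}/s; apply: perm_big; apply: uniq_perm => //=.
- rewrite allpairs_uniq_dep ?fset_uniq //; first last.
  + by move=> [y F] [y' F'] _ _ /= /rcons_inj[-> ->].
  + by move=> *; exact: fset_uniq.
  rewrite andbT; apply/allpairsPdep => -[y [F [_ _]]].
  by case: F.
move=> F; rewrite in_fset_set ?inE; last exact: finite_flags.
apply/idP/idP.
  rewrite inE; case/lastP: F => [//|F y] /flags_rconsP[yP oF].
  apply/orP; right; apply/allpairsPdep; exists y, F; split=> //.
  by rewrite in_fset_set ?inE //; exact: finite_flags.
case/predU1P => [->|]; first by rewrite inE; split.
move=> /allpairsPdep[y [G [yP]]].
rewrite in_fset_set ?inE; last exact: finite_flags.
by move=> oG ->; apply/flags_rconsP.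
Qed.

End FlagSums.

Section FlagRecursion.
Variables (K : fieldType) (n : nat) (P : {fset (set 'rV[K]_n)}).
Implicit Types x y z : set 'rV[K]_n.

(** Induction on the number of members of [P] strictly containing [x]. Since [x] itself may lie
    outside [P], the principle also applies at [set0], the maximum adjoined to the poset. *)
Lemma flat_ind (Q : set 'rV[K]_n -> Prop) :
  (forall x, (forall y, y \in P -> x `<` y -> Q y) -> Q x) -> forall x, Q x.
Proof.
move=> IH x; have [k] := ubnP #|` [fset y in P | `[< x `<` y >]]|.
elim: k x => // k IHk x xk; apply: IH => y yP xy; apply: IHk.
apply: leq_trans (_ : (_ < #|` [fset y in P | `[< x `<` y >]]|)%N) _ => //.
apply: (ltn_card_subset (x := y)).
- move=> z; rewrite !in_fset_sep => /andP[-> yz] /=.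
  apply: (proper_rev_trans yz); exact/asboolP.
- by rewrite in_fset_sep yP; exact/asboolP.
- by rewrite in_fset_sep proper_rev_irr andbF.
Qed.

(** The sum called Omega in the overview, for a general weight. The weight receives the endpoint
    [x], which may lie outside [P]; the value at [set0] involves all flags of non-empty sets. *)
Definition flag_sum (R : nmodType) (g : seq (set 'rV[K]_n) -> set 'rV[K]_n -> R)
    (x : set 'rV[K]_n) : R :=
  \sum_(F \in flags [fset y in P | `[< x `<` y >]]) g F x.

(** If appending [y] multiplies the weight by a factor that depends only on [y] and the new
    endpoint, the flags ending in [y] contribute the flag sum at [y] times that factor. *)
Lemma flag_sumE (R : pzRingType)
    (g : seq (set 'rV[K]_n) -> set 'rV[K]_n -> R) m :
    (forall F y x, g (rcons F y) x = g F y * m y x) ->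
  forall x, flag_sum g x =
    g [::] x + \sum_(y <- P | `[< x `<` y >]) flag_sum g y * m y x.
Proof.
move=> gr x; rewrite /flag_sum sum_flags_rcons; congr (_ + _).
rewrite big_fset /= big_seq_cond [RHS]big_seq_cond; apply: eq_bigr => y.
move=> /andP[yP /asboolP xy].
have -> : [fset z in [fset y in P | `[< x `<` y >]] | `[< y `<` z >]]
        = [fset z in P | `[< y `<` z >]].
  apply/fsetP => z; rewrite !in_fset_sep -andbA; congr (_ && _).
  apply: andb_idl => yz; apply: (proper_rev_trans yz); exact/asboolP.
rewrite !(fsbig_finite _ _ (finite_flags _)) big_distrl.
by apply: eq_bigr => F _; rewrite gr.
Qed.

End FlagRecursion.

(** * Moebius function of intervals *)

Section IntervalMobius.
Variables (K : fieldType) (n : nat) (P : {fset (set 'rV[K]_n)}).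
Implicit Types x y z : set 'rV[K]_n.

(** This is mu(y,x) computed inside one fixed poset [P], so that the Moebius functions of all
    restrictions of an arrangement can be compared and summed together. *)
Fixpoint mobius_fuel y (k : nat) x : int :=
  if k is k'.+1 then
    if x == y then 1
    else - \sum_(z <- P | `[< x `<` z >] && `[< z `<=` y >]) mobius_fuel y k' z
  else 0.

(** Each recursive call replaces the interval by one that no longer contains [x], so fuel equal to
    the size of the interval is enough. *)
Lemma mobius_fuel_irrel y k k' x : x \in P -> x `<=` y ->
    (#|` [fset z in P | `[< x `<=` z >] && `[< z `<=` y >]]| <= k)%N ->
    (#|` [fset z in P | `[< x `<=` z >] && `[< z `<=` y >]]| <= k')%N ->
  mobius_fuel y k x = mobius_fuel y k' x.
Proof.
have pos z : z \in P -> z `<=` y ->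
    (0 < #|` [fset w in P | `[< z `<=` w >] && `[< w `<=` y >]]|)%N.
  move=> zP zy; rewrite cardfs_gt0; apply/fset0Pn; exists z.
  by rewrite in_fset_sep; apply/and3P; split=> //; apply/asboolP.
elim: k k' x => [|k IHk] k' x xP xy xk.
  by have := pos _ xP xy; rewrite ltnNge xk.
case: k' => [|k'] xk'; first by have := pos _ xP xy; rewrite ltnNge xk'.
rewrite /=; case: eqP => // _; congr (- _).
rewrite big_seq_cond [RHS]big_seq_cond; apply: eq_bigr => z.
move=> /andP[zP /andP[/asboolP xz /asboolP zy]].
have lt : (#|` [fset w in P | `[< z `<=` w >] && `[< w `<=` y >]]| <
           #|` [fset w in P | `[< x `<=` w >] && `[< w `<=` y >]]|)%N.
  apply: (ltn_card_subset (x := x)).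
  - move=> w; rewrite !in_fset_sep => /and3P[-> /asboolP zw ->].
    by rewrite andbT; apply/asboolP; apply: subset_trans zw; case: xz.
  - by rewrite in_fset_sep; apply/and3P; split=> //; apply/asboolP.
  - rewrite in_fset_sep; apply/negP => /and3P[_ /asboolP zx _].
    by case: xz.
by apply: IHk => //; rewrite -ltnS; apply: leq_trans lt _.
Qed.

Definition interval_mobius y x : int := mobius_fuel y #|` P| x.

Lemma interval_mobius_refl x : x \in P -> interval_mobius x x = 1.
Proof.
rewrite /interval_mobius; case E: #|` P| => [|k] /=; last by rewrite eqxx.
by move/eqP: E; rewrite cardfs_eq0 => /eqP->.
Qed.

Lemma mobius_fuel_interval y k x : x \in P -> x `<=` y ->
    (#|` [fset z in P | `[< x `<=` z >] && `[< z `<=` y >]]| <= k)%N ->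
  mobius_fuel y k x = interval_mobius y x.
Proof.
move=> xP xy xk; apply: mobius_fuel_irrel => //; apply: fsubset_leq_card.
by apply/fsubsetP => z; rewrite in_fset_sep => /andP[].
Qed.

Lemma sum_interval_mobius y x : x \in P -> y \in P ->
  \sum_(z <- P | `[< x `<=` z >] && `[< z `<=` y >]) interval_mobius y z
  = (x == y)%:R.
Proof.
move=> xP yP; have [xy|nxy] := asboolP (x `<=` y); last first.
  rewrite big_pred0 => [|z].
    by case: eqP => // exy; case: nxy; rewrite exy.
  by apply/negP => /andP[/asboolP xz /asboolP zy]; apply: nxy; exact: subset_trans zy.
have split z : `[< x `<=` z >] && `[< z `<=` y >] && (z != x)
             = `[< x `<` z >] && `[< z `<=` y >].
  rewrite andbAC; congr (_ && _); apply/andP/asboolP.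
    move=> [/asboolP xz /eqP zx]; split=> // zx'; apply: zx.
    by apply/seteqP; split.
  by move=> [xz nzx]; split; [apply/asboolP|apply/eqP => zx; apply: nzx; rewrite zx].
rewrite (bigID (pred1 x)) /= (eq_bigl _ _ split).
rewrite (eq_bigl (pred1 x)) => [|z] /=; last first.
  by apply: andb_idl => /eqP ->; apply/andP; split; apply/asboolP.
rewrite sum_fset_pred1 //.
(* One unit of fuel beyond the size of [P] lets the fixpoint unfold once, leaving in the inner calls
   exactly the fuel used in [interval_mobius]. *)
have xP1 : (#|` [fset z in P | `[< x `<=` z >] && `[< z `<=` y >]]| <= #|` P|.+1)%N.
  apply: leqW; apply: fsubset_leq_card.
  by apply/fsubsetP => z; rewrite in_fset_sep => /andP[].
rewrite -(mobius_fuel_interval xP xy xP1) /=; case: eqP => [-> | _].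
  rewrite big_pred0 ?addr0 // => z.
  by apply/negP => /andP[/asboolP[_ nzy] /asboolP].
by rewrite addrC subrr.
Qed.

(* A left inverse of the square zeta matrix is also a right inverse. *)
Lemma sum_interval_mobius_dual y x : x \in P -> y \in P ->
  \sum_(z <- P | `[< x `<=` z >] && `[< z `<=` y >]) interval_mobius z x
  = (x == y)%:R.
Proof.
move=> xP yP; pose e (i : 'I_(size P)) := nth y P i.
have eP i : e i \in P by apply: mem_nth.
have sumE (f : set 'rV[K]_n -> int) : \sum_(z <- P) f z = \sum_i f (e i).
  by rewrite (big_nth y) big_mkord.
have e_inj i j : (e i == e j) = (i == j).
  by rewrite /e nth_uniq ?fset_uniq.
pose M : 'M[int]_(size P) := \matrix_(i, j)
  if `[< e j `<=` e i >] then interval_mobius (e i) (e j) else 0.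
pose Z : 'M[int]_(size P) := \matrix_(i, j) (`[< e j `<=` e i >] : nat)%:R.
have MZ : M *m Z = 1%:M.
  apply/matrixP => i k; rewrite !mxE -e_inj eq_sym -sum_interval_mobius //.
  rewrite [RHS]big_mkcond [RHS]sumE; apply: eq_bigr => j _; rewrite !mxE.
  by case: asboolP; case: asboolP; rewrite ?mulr1 ?mulr0 ?mul0r.
have /matrixP ZM := mulmx1C MZ.
have xi : (index x P < size P)%N by rewrite index_mem.
have yi : (index y P < size P)%N by rewrite index_mem.
have := ZM (Ordinal yi) (Ordinal xi); rewrite !mxE -e_inj /e /= !nth_index //.
rewrite eq_sym => <-; rewrite [LHS]big_mkcond [LHS]sumE; apply: eq_bigr => j _.
rewrite !mxE /e /= !nth_index //.
by case: asboolP; case: asboolP; rewrite ?mul1r ?mulr0 ?mul0r.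
Qed.

End IntervalMobius.

(** * Flats of localizations and restrictions *)

Section AffineSets.
Variables (K : fieldType) (n : nat).
Implicit Types (E x y : set 'rV[K]_n) (U : {vspace 'rV[K]_n}).

Definition is_affine E : Prop := exists p U, E = [set v | v - p \in U].

Lemma affine_translate p U q :
  q - p \in U -> [set v | v - p \in U] = [set v : 'rV[K]_n | v - q \in U].
Proof.
move=> qp; apply/seteqP; split=> v /= vU.
  have -> : v - q = (v - p) - (q - p) by rewrite opprB addrA subrK.
  exact: memvB.
have -> : v - p = (v - q) + (q - p) by rewrite addrA subrK.
exact: memvD.
Qed.

(** Any subspace picked by [xget] is forced to be [U]: once both descriptions of the coset use the
    same base point, their subspaces have the same members. *)
Lemma direction_affine p U : direction [set v | v - p \in U] = U.
Proof.
rewrite /direction; case: xgetP => [V _ [q eV]|/(_ U)[]]; last by exists p.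
have qp : q - p \in U.
  have : [set v | v - q \in V] q by rewrite /= subrr mem0v.
  by rewrite -eV.
apply/vspaceP => v; rewrite (affine_translate qp) in eV.
have := congr1 (fun E => E (v + q)) eV => /= /propeqP.
by rewrite addrK => vUV; apply/idP/idP => /vUV.
Qed.

Lemma affine_direction E p : is_affine E -> E p ->
  E = [set v | v - p \in direction E].
Proof.
move=> [q [U ->]] /= pU; rewrite direction_affine; exact: affine_translate.
Qed.

Lemma direction_subset x y : is_affine x -> is_affine y -> x `<=` y ->
  (direction x <= direction y)%VS.
Proof.
move=> [p [U ex]] ay xy.
have px : x p by rewrite ex /= subrr mem0v.
have ey := affine_direction ay (xy _ px).
apply/subvP => u; rewrite ex direction_affine => uU.
have : y (u + p) by apply: xy; rewrite ex /= addrK.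
by rewrite {1}ey /= addrK.
Qed.

Lemma leq_affdim x y : is_affine x -> is_affine y -> x `<=` y ->
  (affdim x <= affdim y)%N.
Proof. by move=> ax ay xy; apply: dimvS; exact: direction_subset. Qed.

(** Equal dimensions would give equal directions, and two affine subspaces with a common point and
    the same direction coincide. *)
Lemma ltn_affdim x y : is_affine x -> is_affine y -> x `<` y ->
  (affdim x < affdim y)%N.
Proof.
move=> ax ay [xy nyx]; rewrite ltnNge; apply/negP => dyx; apply: nyx.
have := ax => -[p [U ex]].
have px : x p by rewrite ex /= subrr mem0v.
have : (direction x == direction y)%VS.
  by rewrite eqEdim direction_subset.
move=> /eqP edir v; rewrite (affine_direction ay (xy _ px)) /= -edir.
by rewrite {2}(affine_direction ax px).
Qed.

Lemma is_affine_setT : is_affine setT.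
Proof. by exists 0, fullv; apply/seteqP; split=> v _ //=; rewrite memvf. Qed.

Lemma affdim_setT : affdim (setT : set 'rV[K]_n) = n.
Proof.
rewrite /affdim (_ : setT = [set v | v - 0 \in fullv]).
  by rewrite direction_affine dimvf /dim /= mul1n.
by apply/seteqP; split=> v _ //=; rewrite memvf.
Qed.

Lemma is_affine_bigcap E (S : {fset (set 'rV[K]_n)}) p :
    is_affine E -> E p -> (forall H, H \in S -> is_affine H /\ H p) ->
  is_affine (E `&` \bigcap_(H in [set` S]) H).
Proof.
move=> aE Ep aS; exists p.
have [U memU] : exists U, forall v,
    v \in U <-> forall H, H \in (S : seq _) -> v \in direction H.
  elim: (S : seq _) => [|H s [U memU]].
    by exists fullv => v; rewrite memvf; split.
  exists (direction H :&: U)%VS => v; rewrite memv_cap; split.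
    by move=> /andP[vH /memU vU] G; rewrite inE => /predU1P[->//|]; exact: vU.
  move=> vs; apply/andP; split; first by apply: vs; rewrite mem_head.
  by apply/memU => G Gs; apply: vs; rewrite inE Gs orbT.
exists (direction E :&: U)%VS; apply/seteqP; split=> v /=; rewrite memv_cap.
  move=> [Ev Sv]; apply/andP; split.
    by move: Ev; rewrite {1}(affine_direction aE Ep).
  apply/memU => H HS; have [aH Hp] := aS _ HS.
  by have := Sv H HS; rewrite {1}(affine_direction aH Hp).
move=> /andP[vE /memU vU]; split; first by rewrite (affine_direction aE Ep).
move=> H /= HS; have [aH Hp] := aS _ HS.
by rewrite (affine_direction aH Hp); exact: vU.
Qed.

End AffineSets.

(** * Flats as closed sets, and the intervals of the intersection poset *)

Section Flats.
Variables (K : fieldType) (n : nat).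
Implicit Types (A : arrangement K n) (x y z : set 'rV[K]_n).

(** A subfamily cutting out [x] may be enlarged to all hyperplanes containing [x]. Flats are thus
    the non-empty closed sets, and no subfamily has to be carried around. *)
Lemma flatsP A x : x \in flats A <->
  [/\ x !=set0, x `<=` ambient A &
      forall v, ambient A v ->
        (forall H, H \in hyperplanes A -> x `<=` H -> H v) -> x v].
Proof.
rewrite /flats in_fset_sep; split.
  move=> /andP[/imfsetP[/= S]]; rewrite fpowersetE => /fsubsetP SA ex /set0P x0.
  split=> // [v|v Av Hv]; rewrite ex; first by case.
  split=> // H /= HS; apply: Hv; first exact: SA.
  by rewrite ex => w [_]; exact.
move=> [/set0P -> xA xP]; rewrite andbT; apply/imfsetP => /=.
exists [fset H in hyperplanes A | `[< x `<=` H >]].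
  by rewrite fpowersetE; apply/fsubsetP => H; rewrite in_fset_sep => /andP[].
apply/seteqP; split=> [v xv|v [Av Hv]].
  split; first exact: xA.
  by move=> H /=; rewrite in_fset_sep => /andP[_ /asboolP]; exact.
apply: xP => // H HA xH; apply: Hv => /=.
by rewrite in_fset_sep HA; apply/asboolP.
Qed.

Lemma flats_localization A x : x `<=` ambient A ->
  flats (localization A x) = [fset z in flats A | `[< x `<=` z >]].
Proof.
move=> xA; apply/fsetP => z; rewrite in_fset_sep; apply/idP/andP.
  move=> /flatsP[z0 zA zP]; split.
    apply/flatsP; split=> // v Av Hv; apply: zP => // H.
    by rewrite in_fset_sep => /andP[HA _]; exact: Hv.
  apply/asboolP => v xv; apply: zP; first exact: xA.
  by move=> H; rewrite in_fset_sep => /andP[_ /asboolP xH] _; exact: xH.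
move=> [/flatsP[z0 zA zP] /asboolP xz]; apply/flatsP; split=> // v Av Hv.
apply: zP => // H HA zH; apply: Hv => //; rewrite in_fset_sep HA.
by apply/asboolP; exact: subset_trans zH.
Qed.

(** The flats of the restriction form the interval from [y] to [x]. As [x] need not be a flat,
    [x = set0] gives everything above [y] in the poset. *)
Lemma flats_restriction A x y : y \in flats A -> x `<=` y ->
  flats (restriction (localization A x) y)
  = [fset z in flats A | `[< x `<=` z >] && `[< z `<=` y >]].
Proof.
move=> /flatsP[y0 yA yP] xy; apply/fsetP => z; rewrite in_fset_sep.
have hypP G : G \in hyperplanes (restriction (localization A x) y) <->
    exists H, [/\ H \in hyperplanes A, x `<=` H, ~ (y `<=` H),
                  H `&` y !=set0 & G = H `&` y].
  split.
    move=> /imfsetP[/= H]; rewrite !inE /= => /andP[/andP[HA]].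
    by move=> /asboolP xH /andP[/asboolPn yH /set0P Hy] ->; exists H.
  move=> [H [HA xH yH Hy ->]]; apply/imfsetP; exists H => //=; rewrite !inE /=.
  apply/and3P; split; [apply/andP; split => //; exact/asboolP|exact/asboolPn|].
  exact/set0P.
apply/idP/and3P.
  move=> /flatsP[z0 zy zP]; split; [apply/flatsP; split=> //| |exact/asboolP].
  - exact: subset_trans yA.
  - move=> v Av Hv; have yv : y v.
      by apply: yP => // H HA yH; apply: Hv => //; exact: subset_trans yH.
    apply: zP => // G /hypP[H [HA xH yH Hy ->]] zH; split=> //.
    by apply: Hv => // w /zH[].
  - apply/asboolP => v xv; apply: zP; first exact: xy.
    by move=> G /hypP[H [HA xH yH Hy ->]] _; split; [exact: xH|exact: xy].
move=> [/flatsP[z0 zA zP] /asboolP xz /asboolP zy]; apply/flatsP; split=> //.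
move=> v yv Hv; apply: zP; first exact: yA.
(* A hyperplane containing [y] imposes nothing on points of [y]; any other one containing [z] has a
   trace on [y] that is non-empty because [z] is, hence is a hyperplane of the restriction. *)
move=> H HA zH; have [yH|yH] := pselect (y `<=` H); first exact: yH.
have zHy : z `<=` H `&` y by move=> w zw; split; [exact: zH|exact: zy].
have [] // := Hv (H `&` y) _ zHy; apply/hypP; exists H; split=> //.
  exact: subset_trans zH.
by case: z0 => w zw; exists w; exact: zHy.
Qed.

Lemma mobius_rec_restriction A x y k z : y \in flats A -> x `<=` z ->
    z `<=` y ->
  mobius_rec (restriction (localization A x) y) k z
  = mobius_fuel (flats A) y k z.
Proof.
move=> yA; elim: k z => // k IHk z xz zy /=; case: eqP => // _.
have xy : x `<=` y by exact: subset_trans zy.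
congr (- _); rewrite flats_restriction //; apply: eq_fbig_cond => w.
  rewrite [LHS]in_fset_sep [X in X && _]in_fset_sep [RHS]in_fset_sep.
  rewrite -(andbA (w \in flats A)); congr (_ && _).
  apply/andP/andP => [[/andP[_ wy] zw]//|[/asboolP zw wy]].
  split; [apply/andP; split=> //|]; apply/asboolP => //.
  by case: zw => zw _; exact: subset_trans zw.
rewrite in_fset_sep => /and3P[_ /asboolP xw /asboolP wy] _; exact: IHk.
Qed.

(** Every factor of a flag polynomial becomes a sum over an interval of the single poset [flats A],
    which is what allows exchanging sums over [y] and [z] later. *)
Lemma poincare_restriction A x y : y \in flats A -> x `<=` y ->
  poincare (restriction (localization A x) y)
  = \sum_(z <- flats A | `[< x `<=` z >] && `[< z `<=` y >])
      interval_mobius (flats A) y z *: (- 'X) ^+ (affdim y - affdim z).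
Proof.
move=> yA xy; rewrite /poincare; apply/esym; rewrite big_fset_condE.
rewrite -flats_restriction //; apply: eq_fbigr => z zR _.
have := zR; rewrite flats_restriction // in_fset_sep.
move=> /and3P[zA /asboolP xz /asboolP zy].
rewrite /mobius mobius_rec_restriction //; congr (_ *: _).
apply/esym/mobius_fuel_interval => //; apply: fsubset_leq_card.
apply/fsubsetP => w; rewrite flats_restriction //.
rewrite [in X in X -> _]in_fset_sep [in X in _ -> X]in_fset_sep.
move=> /and3P[-> /asboolP zw ->]; rewrite andbT; apply/asboolP.
exact: subset_trans zw.
Qed.

Lemma eq_poincare A B : ambient A = ambient B -> flats A = flats B ->
  poincare A = poincare B.
Proof.
move=> eqa eqf; rewrite /poincare /mobius /rank eqf eqa.
suff eqm k z : mobius_rec A k z = mobius_rec B k z.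
  by apply: eq_bigr => z _; rewrite eqm.
elim: k z => // k IHk z /=; rewrite eqf eqa; case: ifP => // _.
by congr (- _); apply: eq_bigr => w _; exact: IHk.
Qed.

(** Both sides have the same ambient space and flats, which determine the Poincare polynomial. This
    brings the denominator of [reduced_flag_poincare] to the shape of the first factor of
    [flag_poincare]. *)
Lemma poincare_localization A x : ambient A \in flats A -> x `<=` ambient A ->
  poincare (localization A x)
  = poincare (restriction (localization A x) (ambient A)).
Proof.
move=> aA xA; apply: eq_poincare => //.
rewrite flats_restriction // flats_localization //; apply/fsetP => z.
rewrite [LHS]in_fset_sep [RHS]in_fset_sep.
case: (boolP (z \in flats A)) => //= /flatsP[_ zA _].
by rewrite (asboolT zA) andbT.
Qed.

End Flats.

(** * Characteristic sums *)

Section CharacteristicSums.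
Variables (K : fieldType) (n : nat) (A : arrangement K n).
Variables (R : fieldType) (X : R).
Implicit Types (x y z : set 'rV[K]_n).

Hypothesis affineA : is_affine (ambient A).
Hypothesis affineH : forall H, H \in hyperplanes A -> is_affine H.

Lemma is_affine_flat x : x \in flats A -> is_affine x.
Proof.
rewrite /flats in_fset_sep => /andP[/imfsetP[/= S]].
rewrite fpowersetE => /fsubsetP SA -> /set0P[p [Ap Sp]].
by apply: (is_affine_bigcap (p := p)) => // H HS; split; [exact/affineH/SA|exact: Sp].
Qed.

Lemma flat_ambient x : x \in flats A -> x `<=` ambient A.
Proof. by case/flatsP. Qed.

Lemma ambient_flat : ambient A \in flats A.
Proof.
apply/flatsP; split=> //.
by have [p [U ->]] := affineA; exists p; rewrite /= subrr mem0v.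
Qed.

Lemma rank_add y z : y \in flats A -> z \in flats A -> z `<=` y ->
  (rank A y + (affdim y - affdim z) = rank A z)%N.
Proof.
move=> yA zA zy; rewrite /rank.
have yz := leq_affdim (is_affine_flat zA) (is_affine_flat yA) zy.
have Ay := leq_affdim (is_affine_flat yA) affineA (flat_ambient yA).
by rewrite addnBA // subnK.
Qed.

Lemma rank_gt0 y : y \in flats A -> y != ambient A -> (0 < rank A y)%N.
Proof.
move=> yA ny; rewrite subn_gt0; apply: ltn_affdim => //.
  exact: is_affine_flat.
split; first exact: flat_ambient.
by move=> Ay; case/eqP: ny; apply/seteqP; split=> //; exact: flat_ambient.
Qed.

Definition interval_poincare y x : R :=
  evalz X (poincare (restriction (localization A x) y)).

Lemma interval_poincareE y x : y \in flats A -> x `<=` y ->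
  interval_poincare y x
  = \sum_(z <- flats A | `[< x `<=` z >] && `[< z `<=` y >])
      (interval_mobius (flats A) y z)%:~R * (- X) ^+ (affdim y - affdim z).
Proof.
move=> yA xy; rewrite /interval_poincare poincare_restriction // /evalz.
rewrite rmorph_sum /= horner_sum; apply: eq_bigr => z _.
by rewrite map_polyZ /= rmorphXn rmorphN /= map_polyX !hornerE.
Qed.

Lemma interval_poincare_refl x : x \in flats A -> interval_poincare x x = 1.
Proof.
move=> xA; rewrite interval_poincareE //.
rewrite (eq_bigl (pred1 x)) => [|z]; last first.
  apply/andP/eqP => [[/asboolP xz /asboolP zx]|->]; first exact/seteqP.
  by split; apply/asboolP.
by rewrite sum_fset_pred1 // subnn expr0 mulr1 interval_mobius_refl.
Qed.

Lemma sum_fset_delta (Q : pred (set 'rV[K]_n)) (f : set 'rV[K]_n -> R) c :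
  c \in flats A ->
  \sum_(z <- flats A | Q z) f z * (z == c)%:R = (Q c)%:R * f c.
Proof.
move=> cA; transitivity (\sum_(z <- flats A | z == c) (Q z)%:R * f z).
  rewrite big_mkcond [RHS]big_mkcond; apply: eq_bigr => z _.
  by case: (Q z); case: eqP; rewrite ?mul1r ?mul0r ?mulr1 ?mulr0.
by rewrite sum_fset_pred1.
Qed.

(** Ranks add along the interval, so after expanding [interval_poincare] the power of [- X] depends
    on [z] alone, and exchanging the sums leaves a sum of mu(y,z) over [y]. *)
Lemma sum_rank_interval_poincare H x : H \in flats A -> x `<=` ambient A ->
  \sum_(y <- flats A | `[< x `<=` y >] && ~~ `[< y `<=` H >])
     (- X) ^+ rank A y * interval_poincare y x
  = 1 - `[< x `<=` H >]%:R * (- X) ^+ rank A H.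
Proof.
move=> HA xA.
transitivity (\sum_(y <- flats A | `[< x `<=` y >] && ~~ `[< y `<=` H >])
  \sum_(z <- flats A | `[< x `<=` z >] && `[< z `<=` y >])
     (- X) ^+ rank A z * (interval_mobius (flats A) y z)%:~R).
  apply: eq_fbigr => y yA /andP[/asboolP xy _].
  rewrite interval_poincareE // big_distrr; apply: eq_fbigr => z zA.
  move=> /andP[_ /asboolP zy] /=.
  by rewrite mulrCA -exprD rank_add // mulrC.
rewrite (exchange_big_dep (fun z => `[< x `<=` z >])) /=; last first.
  by move=> y z _ /andP[].
transitivity (\sum_(z <- flats A | `[< x `<=` z >]) (- X) ^+ rank A z *
   ((z == ambient A)%:R - (z == H)%:R)).
  apply: eq_fbigr => z zA /asboolP xz; rewrite -big_distrr /=; congr (_ * _).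
  (* The dual identity for the whole poset sums over all [y] containing [z]; its part with [y]
     inside [H] is the dual identity for [H], so the rest is the difference of the two deltas. *)
  have := sum_interval_mobius_dual zA ambient_flat.
  rewrite (bigID (fun y => `[< y `<=` H >])) /=.
  have -> : \sum_(y <- flats A | (`[< z `<=` y >] && `[< y `<=` ambient A >])
              && `[< y `<=` H >]) interval_mobius (flats A) y z
          = (z == H)%:R.
    rewrite -(sum_interval_mobius_dual zA HA); apply: eq_bigl => y.
    apply/idP/idP => [/andP[/andP[-> _] ->] //|/andP[-> /asboolP yH]].
    apply/andP; split; apply/asboolP => //.
    exact: subset_trans yH (flat_ambient HA).
  move=> /(congr1 (fun m : int => m%:~R : R)); rewrite rmorphD /= rmorph_sum /=.
  rewrite !rmorph_nat => <-; rewrite addrAC subrr add0r.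
  rewrite big_seq_cond [RHS]big_seq_cond; apply: eq_bigl => y.
  case: (boolP (y \in flats A)) => //= yA; apply/idP/idP.
    move=> /andP[/andP[_ nyH] /andP[_ zy]]; rewrite zy nyH andbT.
    exact/asboolP/flat_ambient.
  move=> /andP[/andP[zy _] nyH]; rewrite zy nyH (asboolT xz) !andbT.
  by apply/asboolP; apply: subset_trans xz _; exact/asboolP.
under eq_bigr do rewrite mulrBr.
rewrite big_split /= sumrN !sum_fset_delta ?ambient_flat //.
by rewrite (asboolT xA) mul1r {1}/rank subnn expr0.
Qed.

End CharacteristicSums.

(** * Recursion on flags *)

Lemma sum_fsetD1_cond (R : nmodType) (T : choiceType) (P : {fset T}) a
    (C : pred T) (f : T -> R) :
  \sum_(y <- (P `\ a)%fset | C y) f y = \sum_(y <- P | C y && (y != a)) f y.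
Proof.
apply: eq_fbigl_cond => y; rewrite [LHS]in_fset_sep [RHS]in_fset_sep in_fsetD1.
by rewrite [C y && _]andbC andbCA andbA.
Qed.

Section FlagWeights.
Variables (K : fieldType) (n : nat) (R : fieldType).
Implicit Types (x y z : set 'rV[K]_n) (F : seq (set 'rV[K]_n)).
Variables (pi : set 'rV[K]_n -> set 'rV[K]_n -> R) (u : set 'rV[K]_n -> R).

Fixpoint flag_prod y F x : R :=
  if F is z :: F' then pi y z * flag_prod z F' x else pi y x.

Lemma flag_prod_rcons y F z x :
  flag_prod y (rcons F z) x = flag_prod y F z * pi z x.
Proof. by elim: F y => //= w F IHF y; rewrite IHF mulrA. Qed.

Definition flag_weight y F x : R := flag_prod y F x * \prod_(z <- F) u z.

Lemma flag_weight_rcons y F z x :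
  flag_weight y (rcons F z) x = flag_weight y F z * (u z * pi z x).
Proof.
by rewrite /flag_weight flag_prod_rcons -cats1 big_cat big_seq1 /=
   mulrACA [pi _ _ * _]mulrC.
Qed.

(** The flag weight without the factor from the ambient space to the first flat, which division by
    the Poincare polynomial at the minimum removes. For the empty flag that factor is everything. *)
Definition reduced_flag_weight F x : R :=
  if F is y :: F' then u y * flag_weight y F' x else 1.

(** The factor is the same as for [flag_weight], so the two kinds of flag sums obey the same
    recursion and differ only in the term of the empty flag. *)
Lemma reduced_flag_weight_rcons F z x :
  reduced_flag_weight (rcons F z) x = reduced_flag_weight F z * (u z * pi z x).
Proof.
case: F => [|y F] /=; last by rewrite flag_weight_rcons mulrA.
by rewrite /flag_weight /= big_nil mulr1 mul1r.
Qed.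

End FlagWeights.

Section FlagHilbertPoincare.
Variables (K : fieldType) (n : nat) (A : arrangement K n).
Variables (R : fieldType) (X : R).
Implicit Types (x y z : set 'rV[K]_n) (F : seq (set 'rV[K]_n)).

Local Notation pi := (interval_poincare A X).

Lemma evalz_flag_poincare F :
  evalz X (flag_poincare A F) = flag_prod pi (ambient A) F set0.
Proof.
rewrite /flag_poincare /evalz rmorph_prod horner_prod.
elim: F (ambient A) => [|y F IHF] a /=; first by rewrite big_ord1.
by rewrite big_ord_recl /= -IHF.
Qed.

(** Flats are non-empty, so [set0], the padding value for the end of a flag, behaves as a maximum
    adjoined to the poset. *)
Lemma flags_above_set0 (P : {fset (set 'rV[K]_n)}) : {subset P <= flats A} ->
  [fset y in P | `[< set0 `<` y >]] = P.
Proof.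
move=> PA; apply/fsetP => y; rewrite in_fset_sep; apply: andb_idr => /PA.
move=> /flatsP[[v yv] _ _]; apply/asboolP; split=> //.
by move=> /(_ v yv).
Qed.

Lemma fHP_flag_sum (T : set 'rV[K]_n -> R) :
  fHP X T A = flag_sum (flats A `\ ambient A)%fset
    (flag_weight pi (fun y => T y / (1 - T y)) (ambient A)) set0.
Proof.
rewrite /fHP /flag_sum flags_above_set0; last by move=> y; rewrite !inE => /andP[].
by apply: eq_fsbigr => F _; rewrite evalz_flag_poincare.
Qed.

Hypothesis affineA : is_affine (ambient A).
Hypothesis affineH : forall H, H \in hyperplanes A -> is_affine H.

Lemma mfHP_flag_sum (T : set 'rV[K]_n -> R) :
    (forall x, x `<=` ambient A -> pi (ambient A) x != 0) ->
  mfHP X T A = flag_sum (flats A)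
    (reduced_flag_weight pi (fun y => T y / (1 - T y))) set0.
Proof.
move=> pi_neq0.
rewrite /mfHP /flag_sum flags_above_set0 //; apply: eq_fsbigr => F.
rewrite inE => -[FA _].
rewrite /reduced_flag_poincare evalz_flag_poincare.
have mA : flag_min F `<=` ambient A.
  case: F FA => [|y F] FA; first by move=> v.
  by apply: flat_ambient; apply: FA; rewrite mem_head.
rewrite poincare_localization ?ambient_flat // -/(pi _ _).
case: F FA mA => [|y F] FA mA /=; rewrite ?big_nil ?big_cons /flag_weight.
  by rewrite divff ?mulr1 // pi_neq0.
by rewrite [pi _ _ * _]mulrC mulfK ?pi_neq0 // mulrCA.
Qed.

Variables (H : set 'rV[K]_n) (u : set 'rV[K]_n -> R).
Hypothesis HA : H \in flats A.
Hypothesis rankH : rank A H = 1%N.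
(** This is u = q/(1-q) with q = (-X)^rk and the denominator cleared: the value of T/(1-T) after
    substituting q for T. *)
Hypothesis u_rank : forall y, y \in (flats A `\ ambient A)%fset -> ~ (y `<=` H) ->
  u y * (1 - (- X) ^+ rank A y) = (- X) ^+ rank A y.

Local Notation Omega :=
  (flag_sum (flats A `\ ambient A)%fset (flag_weight pi u (ambient A))).

Lemma ambient_not_subset : ~ (ambient A `<=` H).
Proof.
move=> AH; have eH : H = ambient A.
  by apply/seteqP; split; first exact: flat_ambient.
by move: rankH; rewrite /rank eH subnn.
Qed.

(** The recursion is split according to whether the last flat lies in [H]. The term of the empty
    flag is the summand [y = ambient A], as rank 0 gives (-X)^0 = 1; for [x = ambient A] that
    summand is excluded by [y != x] and appears as the separate indicator. *)
Lemma flag_sum_rec x : x \in flats A \/ x `<=` H -> x `<=` ambient A ->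
    (forall y, y \in (flats A `\ ambient A)%fset -> x `<` y -> ~ (y `<=` H) ->
      Omega y = 1 - (- X) ^+ rank A y) ->
  Omega x =
    \sum_(y <- flats A | `[< x `<=` y >] && ~~ `[< y `<=` H >] && (y != x))
     (- X) ^+ rank A y * pi y x
    + (x == ambient A)%:R
    + \sum_(y <- flats A | `[< x `<` y >] && `[< y `<=` H >])
       Omega y * (u y * pi y x).
Proof.
move=> xAH xA IH.
have properE y : `[< x `<` y >] = `[< x `<=` y >] && (y != x).
  apply/asboolP/andP => [[xy nyx]|[/asboolP xy /eqP nyx]].
    by split; [exact/asboolP|apply/eqP => eyx; apply: nyx; rewrite eyx].
  by split=> // yx; apply: nyx; apply/seteqP.
rewrite (@flag_sumE _ _ _ _ _ (fun y x => u y * pi y x)); last first.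
  by move=> *; exact: flag_weight_rcons.
rewrite /flag_weight /= big_nil mulr1.
rewrite (bigID (fun y => `[< y `<=` H >])) /= addrA addrAC.
congr (_ + _); last first.
  rewrite sum_fsetD1_cond; apply: eq_bigl => y.
  apply: andb_idr => /andP[_ /asboolP yH]; apply/eqP => eyA.
  by apply: ambient_not_subset; rewrite -eyA.
have -> : \sum_(y <- (flats A `\ ambient A)%fset |
       `[< x `<` y >] && ~~ `[< y `<=` H >])
     Omega y * (u y * pi y x)
   = \sum_(y <- (flats A `\ ambient A)%fset |
       `[< x `<` y >] && ~~ `[< y `<=` H >])
     (- X) ^+ rank A y * pi y x.
  apply: eq_fbigr => y yA /andP[/asboolP xy /asboolPn yH].
  by rewrite IH // mulrA [_ * u y]mulrC u_rank.
rewrite sum_fsetD1_cond [in RHS](bigID (pred1 (ambient A))) /= [RHS]addrAC.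
congr (_ + _); last first.
  by apply: eq_bigl => y; congr (_ && _); rewrite properE andbAC.
have [->|xnA] := eqVneq x (ambient A).
  rewrite interval_poincare_refl ?ambient_flat // big_pred0 ?add0r // => y.
  by case: eqP; rewrite ?andbF.
rewrite addr0 (eq_bigl (pred1 (ambient A))) => [|y] /=; last first.
  apply: andb_idl => /eqP ->; rewrite eq_sym xnA andbT; apply/andP; split.
    exact/asboolP.
  exact/asboolPn/ambient_not_subset.
by rewrite sum_fset_pred1 ?ambient_flat // /rank subnn mul1r.
Qed.

(** No flat inside [H] contains a set that is not inside [H], so only the first sum of the recursion
    survives. It is the sum of [sum_rank_interval_poincare], of total 1, without its term for the
    flat itself, which is (-X)^rk. *)
Lemma flag_sum_compl y : y \in (flats A `\ ambient A)%fset -> ~ (y `<=` H) ->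
  Omega y = 1 - (- X) ^+ rank A y.
Proof.
move: y; apply: (flat_ind (P := (flats A `\ ambient A)%fset)) => x IH.
rewrite in_fsetD1 => /andP[xnA xA] xH.
rewrite flag_sum_rec ?(negbTE xnA) ?addr0; last first.
- by move=> y yA xy; exact: IH.
- exact: flat_ambient.
- by left.
rewrite [X in _ + X]big_pred0 ?addr0 => [|y]; last first.
  apply/negP => /andP[/asboolP[xy _] /asboolP yH]; apply: xH.
  exact: subset_trans yH.
have := sum_rank_interval_poincare X affineA affineH HA (flat_ambient xA).
rewrite (asboolF xH) mul0r subr0 (bigID (pred1 x)) /= => <-.
rewrite [in X in X + _ - _](eq_bigl (pred1 x)) => [|y] /=.
  by rewrite sum_fset_pred1 // interval_poincare_refl // mulr1 addrAC subrr add0r.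
apply: andb_idl => /eqP ->; apply/andP; split; [exact/asboolP|exact/asboolPn].
Qed.

(** As [x] lies in [H], the condition [y != x] excludes nothing from the first sum, which therefore
    has the full value 1 - (-X)^1. *)
Lemma flag_sum_hyperplane x : x `<=` H ->
  Omega x = 1 + X
    + \sum_(y <- flats A | `[< x `<` y >] && `[< y `<=` H >])
       Omega y * (u y * pi y x).
Proof.
move=> xH; have xA := subset_trans xH (flat_ambient HA).
have xnA : x != ambient A.
  by apply/eqP => exA; apply: ambient_not_subset; rewrite -exA.
rewrite flag_sum_rec //; last first.
- by move=> y yA _; exact: flag_sum_compl.
- by right.
rewrite (negbTE xnA) addr0; congr (_ + _).
have := sum_rank_interval_poincare X affineA affineH HA xA.
rewrite (asboolT xH) mul1r rankH expr1 opprK => <-; apply: eq_bigl => y.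
apply: andb_idr => /andP[_ /asboolPn yH]; apply/eqP => eyx; apply: yH.
by rewrite eyx.
Qed.

End FlagHilbertPoincare.

(** * Flats of the cone *)

Section ConstantTerm.
Variables (K : fieldType) (n : nat) (A : arrangement K n).
Hypothesis affineA : is_affine (ambient A).
Hypothesis affineH : forall H, H \in hyperplanes A -> is_affine H.

(** The constant term is 1, because [ambient A] is the only flat of rank 0. *)
Lemma poincare_restriction_neq0 x : x `<=` ambient A ->
  poincare (restriction (localization A x) (ambient A)) != 0.
Proof.
move=> xA; have aA := ambient_flat affineA.
apply/eqP => /(congr1 (fun p : {poly int} => p.[0])).
rewrite poincare_restriction // horner_sum horner0.
rewrite (bigID (pred1 (ambient A))) /= [X in _ + X]big1_fset => [|z zA].
  rewrite (eq_bigl (pred1 (ambient A))) => [|z] /=; last first.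
    by apply: andb_idl => /eqP ->; apply/andP; split; apply/asboolP.
  by rewrite sum_fset_pred1 // interval_mobius_refl // subnn !hornerE.
move=> /andP[_ znA]; rewrite hornerZ horner_exp !hornerE /= expr0n.
by rewrite -/(rank A z) gtn_eqF ?mulr0 // rank_gt0.
Qed.

End ConstantTerm.

(** * The hyperplane at infinity of the cone as a copy of the original space *)

Section ConeFlats.
Variables (K : fieldType) (d : nat) (A : {fset (set 'rV[K]_d)}).
Variables (L : set 'rV[K]_d -> affine_form K d) (p : 'rV[K]_d).
Hypothesis defA : defined_by A L.
Hypothesis pA : forall H, H \in A -> H p.
Implicit Types (x y z : set 'rV[K]_d).

Local Notation arrA := (Arrangement setT A).
Local Notation arrB := (cone A L).
Local Notation H0 := (coneH0 (K := K) (d := d)).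

Definition embed_lin : 'Hom('rV[K]_d, 'rV[K]_(1 + d)) :=
  linfun (mulmxr (row_mx 0 1%:M : 'M_(d, 1 + d))).

Lemma embed_linE v : embed_lin v = row_mx 0 v.
Proof. by rewrite lfunE /= mul_mx_row mulmx0 mulmx1. Qed.

Lemma embed_lin_inj : injective embed_lin.
Proof. by move=> v w; rewrite !embed_linE => /eq_row_mx[]. Qed.

(* Identifies K^d with H_0, the common point p going to the origin. *)
Definition embed v := embed_lin (v - p).

Lemma embed_inj : injective embed.
Proof. by move=> v w /embed_lin_inj /addIr. Qed.

Lemma embed_subset x y : embed @` x `<=` embed @` y <-> x `<=` y.
Proof.
split=> [xy v xv|xy _ [v xv <-]]; last by exists v => //; exact: xy.
by have [w yw /embed_inj <-] := xy (embed v) (imageP _ xv).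
Qed.

Lemma embed_proper x y : embed @` x `<` embed @` y <-> x `<` y.
Proof.
by split=> -[xy nyx]; split; rewrite ?embed_subset // -?embed_subset.
Qed.

Lemma image_embed_inj : injective (fun x => embed @` x).
Proof.
by move=> x y exy; apply/seteqP; split; apply/embed_subset; rewrite exy.
Qed.

Lemma coneH0P w : H0 w <-> exists v, w = embed v.
Proof.
split=> [w0|[v ->]].
  exists (rsubmx w + p); rewrite /embed addrK embed_linE -[LHS]hsubmxK.
  congr row_mx; apply/rowP => i; rewrite ord1 !mxE.
  by rewrite -[RHS]w0; congr (w _ _); apply/val_inj.
by rewrite /coneH0 /= /embed embed_linE row_mxEl mxE.
Qed.

(** A form vanishing at [p] takes at [v] the value of its linear part at [v - p], and this is the
    value of the homogenised form at (0, v - p). *)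
Lemma zeros_homogenize_embed (l : affine_form K d) v : zeros l p ->
  zeros (homogenize l) (embed v) <-> zeros l v.
Proof.
rewrite /zeros /= => /eqP; rewrite addrC addr_eq0 => /eqP ->.
by rewrite /embed embed_linE mul_row_col mul0mx add0r addr0 mulmxBl !mxE.
Qed.

Lemma zeros_homogenize H v : H \in A -> zeros (homogenize (L H)) (embed v) <-> H v.
Proof.
move=> HA; have [_ eH] := defA HA.
have eHv w : zeros (L H) w = H w by rewrite -eH.
by rewrite zeros_homogenize_embed eHv //; exact: pA.
Qed.

Lemma mem_cone G : G \in hyperplanes arrB <->
  G = H0 \/ exists2 H, H \in A & G = zeros (homogenize (L H)).
Proof.
rewrite /= in_fset1U; split.
  by move=> /predU1P[->|/imfsetP[/= H HA ->]]; [left|right; exists H].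
move=> [->|[H HA ->]]; first by rewrite eqxx.
by apply/orP; right; apply/imfsetP; exists H.
Qed.

(** The hyperplanes of the cone that contain the image of [x] are [H0] and the homogenisations of
    the hyperplanes containing [x], so both closure conditions of [flatsP] agree. *)
Lemma embed_flat x : embed @` x \in flats arrB <-> x \in flats arrA.
Proof.
split=> /flatsP[[v xv] _ xP]; apply/flatsP; split=> //.
- by case: xv => w xw _; exists w.
- move=> w _ Hw; have [u xu /embed_inj <- //] : (embed @` x) (embed w).
  apply: xP => // G /mem_cone[->|[H HA ->]] xG; first by apply/coneH0P; exists w.
  apply/(zeros_homogenize _ HA); apply: Hw => // u xu.
  by apply/(zeros_homogenize _ HA); apply: xG; exists u.
- by exists (embed v); exists v.
- move=> w _ Hw; have /coneH0P[u eu] : H0 w.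
    apply: Hw; first by apply/mem_cone; left.
    by move=> _ [u xu <-]; apply/coneH0P; exists u.
  exists u => //; apply: xP => // H HA xH; apply/(zeros_homogenize _ HA).
  rewrite -eu; apply: Hw; first by apply/mem_cone; right; exists H.
  by move=> _ [t xt <-]; apply/(zeros_homogenize _ HA); exact: xH.
Qed.

Lemma flat_coneH0 (y : set 'rV[K]_(1 + d)) : y `<=` H0 -> exists x, y = embed @` x.
Proof.
move=> yH; exists (embed @^-1` y); apply/seteqP; split=> [w yw|_ [v yv <-] //].
by have /coneH0P[v ev] := yH w yw; exists v => //=; rewrite -ev.
Qed.

Lemma embed_subset_coneH0 x : embed @` x `<=` H0.
Proof. by move=> _ [v _ <-]; apply/coneH0P; exists v. Qed.

(** Links the identification of the statement, defined by homogenised equations, with the map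
    [embed] used in the computations. *)
Lemma underlineE x : x \in flats arrA -> underline A L x = embed @` x.
Proof.
move=> /flatsP[_ _ xP]; apply/seteqP; split=> [w [xw /coneH0P[v ev]]|_ [v xv <-]].
  exists v => //; apply: xP => // H HA xH; apply/(zeros_homogenize _ HA).
  by rewrite -ev; exact: xw.
split; last by apply/coneH0P; exists v.
by move=> H [/= HA xH]; apply/(zeros_homogenize _ HA); exact: xH.
Qed.

Lemma underline_inv_embed x : x \in flats arrA ->
  underline_inv A L (embed @` x) = x.
Proof.
move=> xA; rewrite /underline_inv; case: xgetP => [z _ [zA]|/(_ x)[]].
  by rewrite underlineE // => /image_embed_inj.
by split=> //; exact: underlineE.
Qed.

Lemma embed_affine q (U : {vspace 'rV[K]_d}) :
  embed @` [set v | v - q \in U] = [set w | w - embed q \in (embed_lin @: U)%VS].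
Proof.
apply/seteqP; split=> [_ [v /= vU <-]|w /= /memv_imgP[v vU ew]].
  by rewrite -raddfB /= opprB addrA subrK memv_img.
exists (v + q) => /=; first by rewrite addrK.
by rewrite -[RHS](subrK (embed q)) ew -raddfD addrA.
Qed.

Lemma is_affine_embed x : is_affine x -> is_affine (embed @` x).
Proof.
by move=> [q [U ->]]; exists (embed q), (embed_lin @: U)%VS; exact: embed_affine.
Qed.

Lemma affdim_embed x : is_affine x -> affdim (embed @` x) = affdim x.
Proof.
move=> [q [U ->]]; rewrite embed_affine /affdim !direction_affine.
apply: limg_dim_eq; apply/eqP; rewrite -subv0; apply/subvP => v.
rewrite memv_cap memv_ker memv0 => /andP[_ /eqP v0].
by apply/eqP/embed_lin_inj; rewrite v0 linear0.
Qed.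

Lemma sum_flats_embed (R : nmodType) (C : pred (set 'rV[K]_(1 + d)))
    (f : set 'rV[K]_(1 + d) -> R) :
  \sum_(w <- flats arrB | C w && `[< w `<=` H0 >]) f w
  = \sum_(x <- flats arrA | C (embed @` x)) f (embed @` x).
Proof.
transitivity (\sum_(w <- [fset embed @` x | x in flats arrA] | C w) f w).
  apply: eq_fbigl_cond => w; rewrite [LHS]in_fset_sep [RHS]in_fset_sep andbCA andbC.
  congr (_ && _); apply/andP/imfsetP => [[wB /asboolP wH]|[/= x xA ->]].
    have [x ex] := flat_coneH0 wH; exists x => //.
    by apply/embed_flat; rewrite -ex.
  split; first exact/embed_flat.
  exact/asboolP/embed_subset_coneH0.
rewrite big_mkcond big_imfset /=; first by rewrite -big_mkcond.
by move=> x y _ _; exact: image_embed_inj.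
Qed.

End ConeFlats.

Lemma is_affine_zeros (K : fieldType) m (l : affine_form K m) q :
  zeros l q -> is_affine (zeros l).
Proof.
move=> lq; exists q, (lker (linfun (mulmxr l.1))); apply/seteqP.
have key v : zeros l v <-> v - q \in lker (linfun (mulmxr l.1)).
  rewrite memv_ker lfunE /= mulmxBl /zeros /=.
  have := lq; rewrite /zeros /= => /eqP; rewrite addrC addr_eq0 => /eqP ->.
  split=> [/eqP|/eqP e]; rewrite ?subr_eq0.
    by move=> /eqP e; apply/eqP/matrixP => i j; rewrite !ord1.
  by apply/eqP; rewrite subr_eq0 (subr0_eq e).
by split=> v /key.
Qed.

(** * Transfer of intervals to the cone and comparison of the two series *)

Section ConeSeries.
Variables (K : fieldType) (d : nat) (A : {fset (set 'rV[K]_d)}).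
Variables (L : set 'rV[K]_d -> affine_form K d) (p : 'rV[K]_d).
Hypothesis defA : defined_by A L.
Hypothesis pA : forall H, H \in A -> H p.
Implicit Types (x y z : set 'rV[K]_d).

Local Notation arrA := (Arrangement setT A).
Local Notation arrB := (cone A L).
Local Notation H0 := (coneH0 (K := K) (d := d)).
Local Notation embed := (embed p).

Lemma is_affine_hyperplane H : H \in A -> is_affine H.
Proof.
move=> HA; have [_ eH] := defA HA; rewrite eH; apply: (is_affine_zeros (q := p)).
by have := pA HA; rewrite {1}eH.
Qed.

Lemma coneH0_embed : H0 = embed @` setT.
Proof.
by apply/seteqP; split=> [w /(coneH0P p)[v ->]|_ [v _ <-]];
  [exists v|apply/(coneH0P p); exists v].
Qed.

Lemma is_affine_cone_hyperplane G : G \in hyperplanes arrB -> is_affine G.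
Proof.
move=> /mem_cone[->|[H HA ->]].
  by rewrite coneH0_embed; apply: is_affine_embed; exact: is_affine_setT.
by apply: (is_affine_zeros (q := 0)); rewrite /zeros /= mul0mx mxE addr0.
Qed.

Lemma setT_flat : setT \in flats arrA.
Proof. by apply/flatsP; split=> //; exists 0. Qed.

Lemma coneH0_flat : H0 \in flats arrB.
Proof. by rewrite coneH0_embed; apply/(embed_flat defA pA); exact: setT_flat. Qed.

Lemma rank_coneH0 : rank arrB H0 = 1%N.
Proof.
rewrite /rank /= affdim_setT coneH0_embed affdim_embed; last exact: is_affine_setT.
by rewrite affdim_setT addnK.
Qed.

Lemma interval_mobius_embed y z : z \in flats arrA -> z `<=` y ->
  interval_mobius (flats arrB) (embed @` y) (embed @` z)
  = interval_mobius (flats arrA) y z.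
Proof.
(* The fuel [k] suffices for both posets; with equal fuel the two recursions can be matched by
   induction on it. *)
move=> zA zy; pose k := (#|` flats arrB| + #|` flats arrA|)%N.
have zB : embed @` z \in flats arrB by apply/(embed_flat defA pA).
rewrite -(@mobius_fuel_interval _ _ _ _ k) //; first last.
- apply: leq_trans (fsubset_leq_card _) (leq_addr _ _).
  by apply/fsubsetP => w; rewrite [in X in X -> _]in_fset_sep => /andP[].
- exact/embed_subset.
rewrite -(@mobius_fuel_interval _ _ (flats arrA) _ k) //; last first.
  apply: leq_trans (fsubset_leq_card _) (leq_addl _ _).
  by apply/fsubsetP => w; rewrite [in X in X -> _]in_fset_sep => /andP[].
elim: k z {zA zy zB} => // k IHk z /=.
rewrite (inj_eq (image_embed_inj (p := p))); case: eqP => // _; congr (- _).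
transitivity (\sum_(w <- flats arrB | (`[< embed @` z `<` w >] &&
   `[< w `<=` embed @` y >]) && `[< w `<=` H0 >])
   mobius_fuel (flats arrB) (embed @` y) k w).
  (* Every flat in the interval lies in the image of [y], hence in [H0], so the added condition is
     free and [sum_flats_embed] applies. *)
  apply: eq_bigl => w; apply/esym/andb_idr => /andP[_ /asboolP wy].
  exact/asboolP/(subset_trans wy)/embed_subset_coneH0.
rewrite (sum_flats_embed defA pA); apply: eq_big => [w|w _]; last exact: IHk.
by congr (_ && _); apply/asboolP/asboolP; rewrite ?embed_proper ?embed_subset.
Qed.

Variables (R : fieldType) (X : R).

Lemma interval_poincare_embed y x : y \in flats arrA -> x `<=` y ->
  interval_poincare arrB X (embed @` y) (embed @` x)
  = interval_poincare arrA X y x.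
Proof.
move=> yA xy.
rewrite !interval_poincareE //; [|exact/(embed_flat defA pA)|exact/embed_subset].
transitivity (\sum_(w <- flats arrB | (`[< embed @` x `<=` w >] &&
   `[< w `<=` embed @` y >]) && `[< w `<=` H0 >])
   (interval_mobius (flats arrB) (embed @` y) w)%:~R
     * (- X) ^+ (affdim (embed @` y) - affdim w)).
  apply: eq_bigl => w; apply/esym/andb_idr => /andP[_ /asboolP wy].
  exact/asboolP/(subset_trans wy)/embed_subset_coneH0.
rewrite (sum_flats_embed defA pA); apply: eq_fbig_cond => w.
  rewrite [LHS]in_fset_sep [RHS]in_fset_sep; congr (_ && (_ && _)).
    by apply/asboolP/asboolP; rewrite ?embed_subset.
  by apply/asboolP/asboolP; rewrite ?embed_subset.
move=> wA /andP[_ /asboolP /embed_subset wy].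
rewrite interval_mobius_embed // !affdim_embed //.
all: apply: (is_affine_flat (A := arrA)) => //.
all: by [exact: is_affine_setT|exact: is_affine_hyperplane].
Qed.

Hypothesis evalz_neq0 : forall q : {poly int}, q != 0 -> evalz X q != 0.

(** For positive [k] the polynomial (-X)^k - 1 has constant term -1, so it is non-zero and stays so
    at [X]. This makes the substituted denominators 1 - (-X)^rk invertible. *)
Lemma rank_power_neq1 k : (0 < k)%N -> (- X) ^+ k != 1.
Proof.
move=> k0; have := @evalz_neq0 ((- 'X) ^+ k - 1).
rewrite /evalz rmorphB rmorphXn rmorphN rmorph1 /= map_polyX !hornerE !subr_eq0.
apply; apply/eqP => /(congr1 (fun q : {poly int} => q.[0])).
by rewrite horner_exp !hornerE expr0n gtn_eqF.
Qed.

Theorem cone_fHP (T : set 'rV[K]_d -> R) :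
  (1 + X) * mfHP X T arrA = fHP X (cone_subst A L X T) arrB.
Proof.
have affineT m : is_affine [set: 'rV[K]_m] by exact: is_affine_setT.
rewrite mfHP_flag_sum //; last first.
  move=> x xA; apply: evalz_neq0; apply: poincare_restriction_neq0 => //.
  exact: is_affine_hyperplane.
(* The empty set is its own image, so the identity can be generalised from [set0] to any [x] on the
   left and its image on the right, and proved by induction on [x]. *)
rewrite fHP_flag_sum -[set0 in RHS](image_set0 embed).
elim/(flat_ind (P := flats arrA)): set0 => x IHx.
set u := fun y : set 'rV[K]_(1 + d) => _ / _.
have u_rank (y : set 'rV[K]_(1 + d)) :
    y \in (flats arrB `\ ambient arrB)%fset -> ~ (y `<=` H0) ->
    u y * (1 - (- X) ^+ rank arrB y) = (- X) ^+ rank arrB y.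
  rewrite in_fsetD1 => /andP[ynT yB] yH.
  rewrite /u /cone_subst asboolF // divfK // subr_eq0 eq_sym.
  apply: rank_power_neq1; apply: rank_gt0 => //.
  exact: is_affine_cone_hyperplane.
rewrite (flag_sum_hyperplane _ _ coneH0_flat rank_coneH0 u_rank) //; first last.
- exact: embed_subset_coneH0.
- exact: is_affine_cone_hyperplane.
rewrite (@flag_sumE _ _ _ _ _ (fun y x => T y / (1 - T y) *
  interval_poincare arrA X y x)) /=; last first.
  by move=> *; exact: reduced_flag_weight_rcons.
(* The empty flag has reduced weight 1 and thus contributes 1 + X, the initial term on the cone
   side; the remaining sums run over corresponding flats. *)
rewrite mulrDr mulr1 (sum_flats_embed defA pA); congr (_ + _).
rewrite big_distrr /=; apply: eq_fbig_cond => y.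
  rewrite [LHS]in_fset_sep [RHS]in_fset_sep; congr (_ && _).
  by apply/asboolP/asboolP; rewrite ?embed_proper.
move=> yA /asboolP xy; rewrite [LHS]mulrA IHx //.
rewrite interval_poincare_embed //; last by case: xy.
congr (_ * (_ * _)); rewrite /u /cone_subst asboolT.
2: exact: embed_subset_coneH0.
by rewrite (underline_inv_embed defA pA).
Qed.

End ConeSeries.

(** Evaluation at [varX] is the inclusion of Z[X] in the fraction field, as constants of the
    polynomial ring in the other indeterminates, and so is injective. *)
Lemma evalz_varX_neq0 (K : fieldType) (n : nat) (P : {fset (set 'rV[K]_n)})
  (q : {poly int}) : q != 0 -> evalz (varX P) q != 0.
Proof.
suff -> : evalz (varX P) q = tofrac (q%:MP) by rewrite tofrac_eq0 mpolyC_eq0.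
rewrite /evalz /map_poly horner_poly -[in RHS](coefK q) poly_def !rmorph_sum /=.
apply: eq_bigr => i _; rewrite -mul_polyC /varX -[in RHS](intz q`_i) !rmorphM /=.
by rewrite !rmorphXn !rmorph_int.
Qed.

Theorem theorem1p4 (K : fieldType) (charK : [pchar K] =i pred0) (d : nat)
    (A : {fset (set 'rV[K]_d)}) (L : set 'rV[K]_d -> affine_form K d)
    (defA : defined_by A L) (centralA : central (Arrangement setT A)) :
  let X := varX (flats (Arrangement setT A)) in
  let T := varT (flats (Arrangement setT A)) in
  (1 + X) * mfHP X T (Arrangement setT A)
  = fHP X (cone_subst A L X T) (cone A L).
Proof.
have [p [_ pA]] := centralA.
exact: (cone_fHP defA pA (@evalz_varX_neq0 _ _ _)).
Qed.
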